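(* Let $m\ge1$, $n\ge0$ be integers, $\mu\in\mathbb{C}$, and let $W=\bigoplus_{s\ge0}W_s$, $V(\mu)$ and $S$ be as in the context. (1) The character of the $\mathfrak{gl}_{m|n}(\mathbb{C})$-module $W$ is $$Ch(W)=\sum_{\alpha\in P}e(\mu\epsilon_1)e(\alpha),$$ where $P$ is the set of all $\sum_{i=1}^{m+n-1}-t_i\alpha_i$ with integers $t_1\ge t_2\ge\dots\ge t_{m+n-1}\ge t_{m+n}=0$ such that $t_j-t_{j+1}\in\{0,1\}$ for $m\le j\le m+n-1$. (2) If $\mu$ is a nonnegative integer, the character of $V(\mu)$ is $$Ch(V(\mu))=\sum_{\alpha\in Q}e(\mu\epsilon_1)e(\alpha),$$ where $Q=\{\sum_{i=1}^{m+n-1}-t_i\alpha_i\in P \mid t_1\ge\mu+1\}$. (3) If $m\ge2$, then every homogeneous subspace $W_s$ ($s\in\mathbb{Z}_{\ge0}$) of $W$ is an irreducible highest weight module of $S$, with highest weight vector $x_2^s$ of weight $s\epsilon_2$. (4) If $m=1$, then every homogeneous subspace $W_s$ ($s\in\{0,1,\dots,n\}$) of $W$ is an irreducible highest weight module of $S$, with highest weight vector $y_1y_2\cdots y_s$ of weight $\epsilon_2+\epsilon_3+\cdots+\epsilon_{s+1}$.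
   Context: All vector spaces and algebras are over $\mathbb{C}$. $\mathfrak{gl}_{m|n}(\mathbb{C})$ is the general linear Lie superalgebra with matrix units $E_{i,j}$, $1\le i,j\le m+n$ (indices $1,\dots,m$ even, $m+1,\dots,m+n$ odd). $\mathfrak{h}$ is its Cartan subalgebra of diagonal matrices, $\epsilon_1,\dots,\epsilon_{m+n}$ is the basis of $\mathfrak{h}^*$ dual to $E_{1,1},\dots,E_{m+n,m+n}$, and $\alpha_i=\epsilon_i-\epsilon_{i+1}$ for $1\le i\le m+n-1$. The character of a weight module $M$ with finite-dimensional weight spaces $M_\lambda$ is $Ch(M)=\sum_{\lambda\in\mathfrak{h}^*}\dim(M_\lambda)\,e(\lambda)$, with formal exponentials satisfying $e(\lambda)e(\lambda')=e(\lambda+\lambda')$. $W$ is the associative algebra generated by $x_2,\dots,x_m,y_1,\dots,y_n$ subject to $x_ix_j=x_jx_i$, $x_iy_k=y_kx_i$, $y_ky_l=-y_ly_k$ (so $W\cong\mathbb{C}[x_2,\dots,x_m]\otimes\bigwedge^*(\mathbb{C}y_1\oplus\cdots\oplus\mathbb{C}y_n)$), with $x_i$ even and $y_k$ odd. $\frac{\partial}{\partial x_i}$ (even) and $\frac{\partial}{\partial y_k}$ (odd) are the partial differential operators on $W$, with $[\frac{\partial}{\partial x_i},x_j]=\delta_{i,j}$ and $\frac{\partial}{\partial y_k}y_l+y_l\frac{\partial}{\partial y_k}=\delta_{k,l}$. $W$ is a $\mathfrak{gl}_{m|n}(\mathbb{C})$-module with $E_{i,j}$ acting as $e_{i,j}$,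 where for $i,j=2,\dots,m$ and $k,l=1,\dots,n$: $e_{1,1}=\mu-\sum_{s=2}^m x_s\frac{\partial}{\partial x_s}-\sum_{t=1}^n y_t\frac{\partial}{\partial y_t}$, $e_{i,1}=x_i$, $e_{m+k,1}=y_k$, $e_{1,i}=e_{1,1}\frac{\partial}{\partial x_i}$, $e_{1,m+k}=e_{1,1}\frac{\partial}{\partial y_k}$, $e_{i,j}=x_i\frac{\partial}{\partial x_j}$, $e_{i,m+k}=x_i\frac{\partial}{\partial y_k}$, $e_{m+k,i}=y_k\frac{\partial}{\partial x_i}$, $e_{m+k,m+l}=y_k\frac{\partial}{\partial y_l}$. $W_s$ is the space of homogeneous elements of degree $s$, where every $x_i$ and $y_k$ has degree $1$. For $\mu$ a nonnegative integer, $V(\mu)$ is the submodule of $W$ generated by $x_2^{\mu+1}$ if $m\ge2$, and by $y_1y_2\cdots y_{\mu+1}$ if $m=1$ and $\mu\le n-1$; if $m=1$ and $\mu\ge n$, $V(\mu)=0$. $S$ is the Lie subsuperalgebra of $\mathfrak{gl}(W)$ generated by the $e_{i,j}$ with $i,j=2,\dots,m+n$; it is isomorphic to $\mathfrak{gl}_{m-1|n}(\mathbb{C})$. Its Cartan subalgebra is spanned by $e_{2,2},\dots,e_{m+n,m+n}$, with dual basis again denoted $\epsilon_2,\dots,\epsilon_{m+n}$. A highest weight vector for $S$ is a weight vector killed by all $e_{i,j}$ with $2\le i<j\le m+n$ and generating the module. *)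

(* Defs.v *)
From HB Require Import structures.
From mathcomp Require Import all_boot all_order all_algebra.
From mathcomp Require Import mpoly.

Set Implicit Arguments.
Unset Strict Implicit.
Unset Printing Implicit Defensive.

Import GRing.Theory.
Local Open Scope ring_scope.

(* W = C[x_2, ..., x_m] (x) /\(C y_1 + ... + C y_n).  An element f is stored
   as the family of its components f A in C[x_2, ..., x_m], one for each subset
   A = {k_1 < ... < k_r}, so that f = \sum_A f A * y_{k_1} ... y_{k_r}.
   The polynomial variable of index k : 'I_m.-1 is x_{k+2} and the element
   k : 'I_n stands for y_{k+1}. *)
Definition W (F : comNzRingType) (m n : nat) :=
  {ffun {set 'I_n} -> {mpoly F[m.-1]}}.

HB.instance Definition _ (F : comNzRingType) (m n : nat) :=
  GRing.Lmodule.on (W F m n).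

(* y_A y_B = (-1)^(inversions A B) y_(A U B) for disjoint A and B *)
Definition inversions (n : nat) (A B : {set 'I_n}) : nat :=
  #|[set p : 'I_n * 'I_n | [&& p.1 \in A, p.2 \in B & (p.2 < p.1)%N]]|.

Section Algebra.
Variables (F : comNzRingType) (m n : nat).
Local Notation W := (W F m n).
Implicit Types (f g h : W) (A B U : {set 'I_n}).

Definition oneW : W := [ffun A : {set 'I_n} => (A == set0)%:R].

Definition mulW f g : W :=
  [ffun U : {set 'I_n} => \sum_(A : {set 'I_n} | A \subset U)
     (-1) ^+ inversions A (U :\: A) * (f A * g (U :\: A))].

Lemma inversions0n A : inversions set0 A = 0%N.
Proof. by apply/eqP; rewrite cards_eq0; apply/eqP/setP => p; rewrite !inE. Qed.

Lemma inversionsn0 A : inversions A set0 = 0%N.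
Proof.
by apply/eqP; rewrite cards_eq0; apply/eqP/setP => p; rewrite !inE andbF.
Qed.

Lemma inversionsUl A B U : [disjoint A & B] ->
  inversions (A :|: B) U = (inversions A U + inversions B U)%N.
Proof.
move=> dAB; rewrite /inversions -cardsUI.
set X := (X in (_ + #|pred_of_set X|)%N); have -> : X = set0.
  apply/setP => p; rewrite !inE; apply/negP => /andP[/and3P[pA _ _]].
  by case/and3P=> pB _ _; rewrite (disjointFr dAB pA) in pB.
by rewrite cards0 addn0; apply: eq_card => p; rewrite !inE -andb_orl.
Qed.

Lemma inversionsUr A B U : [disjoint A & B] ->
  inversions U (A :|: B) = (inversions U A + inversions U B)%N.
Proof.
move=> dAB; rewrite /inversions -cardsUI.
set X := (X in (_ + #|pred_of_set X|)%N); have -> : X = set0.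
  apply/setP => p; rewrite !inE; apply/negP => /andP[/and3P[_ pA _]].
  by case/and3P=> _ pB _; rewrite (disjointFr dAB pA) in pB.
rewrite cards0 addn0; apply: eq_card => p; rewrite !inE.
by case: (p.1 \in U) => //=; rewrite andb_orl.
Qed.

Lemma mulWA : associative mulW.
Proof.
move=> f g h; apply/ffunP => U; rewrite !ffunE.
under eq_bigr => A sAU do rewrite ffunE !mulr_sumr.
under [RHS]eq_bigr => B sBU do rewrite ffunE mulr_suml mulr_sumr.
rewrite [RHS](exchange_big_dep (fun A : {set 'I_n} => A \subset U)) /=; last first.
  by move=> B A sBU sAB; apply: subset_trans sBU.
apply: eq_bigr => A sAU.
rewrite [RHS](reindex_onto (fun C => A :|: C) (fun B => B :\: A)) /=; last first.
  by move=> B /andP[_ sAB]; rewrite setDE setUIr setUCr setIT; apply/setUidPr.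
have condE (C : {set 'I_n}) : (C \subset U :\: A) =
    ((A :|: C \subset U) && (A \subset A :|: C) && ((A :|: C) :\: A == C)).
  rewrite subsetUl andbT subUset sAU /= setDUl setDv set0U subsetD.
  congr (_ && _); rewrite disjoints_subset; apply/setIidPl/eqP => [<-|]; rewrite setDE -?setIA ?setIid //.
apply: eq_big => [//|C sC].
have dAC : [disjoint A & C].
  by move: sC; rewrite subsetD disjoint_sym => /andP[].
have E1 : ((A :|: C) :\: A = C).
  by apply/eqP; move: sC; rewrite condE => /andP[].
have E2 : (U :\: A :\: C = U :\: (A :|: C)) by rewrite setDDl.
rewrite E1 E2; set D := (U :\: (A :|: C)).
have dCD : [disjoint C & D].
  by rewrite -setI_eq0 /D setDE setCU setIA setICA setIA -setIA setICr !setI0.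
have E3 : (U :\: A = C :|: D).
  rewrite /D -setDDl; apply/setP => k; move/subsetP/(_ k): sC.
  by rewrite !inE; case: (k \in C) => //= ->.
rewrite E3 inversionsUr // inversionsUl // !exprD.
set s1 := _ ^+ inversions A C; set s2 := _ ^+ inversions A D; set s3 := _ ^+ inversions C D.
by rewrite -!mulrA (mulrCA (f A)) [in RHS](mulrCA s3) [in RHS](mulrCA s2).
Qed.

Lemma mulW1l : left_id oneW mulW.
Proof.
move=> f; apply/ffunP => U; rewrite ffunE (bigD1 set0) ?sub0set //= big1 ?addr0.
  by rewrite inversions0n ffunE eqxx !mul1r setD0.
by move=> A /andP[_ /negPf A0]; rewrite ffunE A0 mul0r mulr0.
Qed.

Lemma mulW1r : right_id oneW mulW.
Proof.
move=> f; apply/ffunP => U; rewrite ffunE (bigD1 U) //= big1 ?addr0.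
  by rewrite setDv inversionsn0 ffunE eqxx mul1r mulr1.
move=> A /andP[sAU neqA]; rewrite ffunE setD_eq0.
have /negPf-> : ~~ (U \subset A) by move: neqA; rewrite eqEsubset sAU.
by rewrite !mulr0.
Qed.

Lemma mulWDl : left_distributive mulW +%R.
Proof.
move=> f g h; apply/ffunP => U; rewrite !ffunE -big_split /=.
by apply: eq_bigr => A _; rewrite !ffunE mulrDl mulrDr.
Qed.

Lemma mulWDr : right_distributive mulW +%R.
Proof.
move=> f g h; apply/ffunP => U; rewrite !ffunE -big_split /=.
by apply: eq_bigr => A _; rewrite !ffunE !mulrDr.
Qed.

Lemma oneW_neq0 : oneW != 0.
Proof.
apply/eqP => /ffunP/(_ set0); rewrite !ffunE eqxx => /eqP.
by rewrite oner_eq0.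
Qed.

HB.instance Definition _ := GRing.Zmodule_isNzRing.Build W
  mulWA mulW1l mulW1r mulWDl mulWDr oneW_neq0.

Lemma mulWE f g U : (f * g) U =
  \sum_(A : {set 'I_n} | A \subset U)
     (-1) ^+ inversions A (U :\: A) * (f A * g (U :\: A)).
Proof. by rewrite ffunE. Qed.

Lemma scaleWAl (a : F) f g : a *: (f * g) = (a *: f) * g.
Proof.
apply/ffunP => U; rewrite !ffunE scaler_sumr; apply: eq_bigr => A _.
by rewrite !ffunE -scalerAl -scalerAr.
Qed.

Lemma scaleWAr (a : F) f g : a *: (f * g) = f * (a *: g).
Proof.
apply/ffunP => U; rewrite !ffunE scaler_sumr; apply: eq_bigr => A _.
by rewrite !ffunE -!scalerAr.
Qed.

HB.instance Definition _ := GRing.Lmodule_isLalgebra.Build F W scaleWAl.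
HB.instance Definition _ := GRing.Lalgebra_isAlgebra.Build F W scaleWAr.

Definition X (i : 'I_m.-1) : W :=
  [ffun A : {set 'I_n} => if A == set0 then 'X_i else 0].

Definition Y (k : 'I_n) : W := [ffun A : {set 'I_n} => (A == [set k])%:R].

Definition dX (i : 'I_m.-1) f : W := [ffun A : {set 'I_n} => (f A)^`M(i)].

(* the left derivation: d/dy_k (y_k y_A) = y_A for k not in A *)
Definition dY (k : 'I_n) f : W :=
  [ffun A : {set 'I_n} => if k \in A then 0
     else (-1) ^+ inversions [set k] A * f (k |: A)].

Lemma mulXE i f A : (X i * f) A = 'X_i * f A.
Proof.
rewrite mulWE (bigD1 set0) ?sub0set //= big1 ?addr0.
  by rewrite inversions0n ffunE eqxx !mul1r setD0.
by move=> B /andP[_ /negPf B0]; rewrite ffunE B0 mul0r mulr0.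
Qed.

Lemma mulYE k f A : (Y k * f) A =
  if k \in A then (-1) ^+ inversions [set k] (A :\ k) * f (A :\ k) else 0.
Proof.
rewrite mulWE; case: ifPn => kA.
  rewrite (bigD1 [set k]) ?sub1set //= big1 ?addr0.
    by rewrite ffunE eqxx !mul1r.
  by move=> B /andP[_ /negPf B0]; rewrite ffunE B0 mul0r mulr0.
apply: big1 => B sBA; rewrite ffunE; case: eqP sBA => [->|_ _].
  by rewrite sub1set (negPf kA).
by rewrite mul0r mulr0.
Qed.

Lemma XXC i j : X i * X j = X j * X i.
Proof.
apply/ffunP => A; rewrite !mulXE !ffunE.
by case: eqP; rewrite ?mulr0 // mulrC.
Qed.

Lemma XYC i k : X i * Y k = Y k * X i.
Proof.
apply/ffunP => A; rewrite mulXE mulYE !ffunE setD_eq0.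
have [->|neqA] := eqVneq A [set k].
  by rewrite in_set1 eqxx subxx setDv inversionsn0 mul1r mulr1.
rewrite mulr0 subset1 (negPf neqA) /=; case: ifP => // kA.
by case: eqP kA => [->|_]; rewrite ?inE // mulr0.
Qed.

Lemma inversions1 (k l : 'I_n) : inversions [set k] [set l] = (l < k)%N.
Proof.
rewrite /inversions; case: ltnP => [ltlk|lekl].
  rewrite (_ : [set p | _] = [set (k, l)]) ?cards1 //.
  apply/setP => -[a b]; rewrite !inE /= xpair_eqE.
  by case: eqP => // ->; case: eqP => // ->.
apply/eqP; rewrite cards_eq0; apply/eqP/setP => -[a b]; rewrite !inE /=.
by case: eqP => // ->; case: eqP => // ->; rewrite ltnNge lekl.
Qed.

Lemma sign_inversions1 (k l : 'I_n) : k != l ->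
  (-1) ^+ inversions [set k] [set l] = - (-1) ^+ inversions [set l] [set k] :> {mpoly F[m.-1]}.
Proof.
by rewrite !inversions1 neq_ltn; case: ltngtP => //= _ _; rewrite ?opprK.
Qed.

Lemma YYC k l : Y k * Y l = - (Y l * Y k).
Proof.
apply/ffunP => A; rewrite mulYE [RHS]ffunE mulYE; do 2!rewrite ffunE.
have [->|nkl] := eqVneq k l.
  have /negPf-> : A :\ l != [set l].
    by apply/eqP => /setP/(_ l); rewrite !inE eqxx.
  by rewrite mulr0 if_same oppr0.
have DE (a b : 'I_n) : a != b -> (A :\ a == [set b]) && (a \in A) = (A == [set a; b]).
  move=> nab; apply/andP/eqP => [[/eqP <- aA]|->]; first by rewrite setD1K.
  by rewrite setU1K ?inE ?eqxx.
have := DE _ _ nkl; have := DE l k; rewrite eq_sym setUC => /(_ nkl) <-.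
case: eqP => [->|_]; case: eqP => [->|_]; case: (l \in A); case: (k \in A) => //= _;
  by rewrite ?mulr0 ?oppr0 ?mulr1 // sign_inversions1.
Qed.

Lemma dXX i j f : dX i (X j * f) - X j * dX i f = (i == j)%:R *: f.
Proof.
apply/ffunP => A; rewrite ffunE [X in X + _]ffunE [X in _ + X]ffunE !mulXE !ffunE mderivM mderivX mnm1E eq_sym addrK.
case: eqVneq => [->|_]; last by rewrite !scale0r mul0r.
by rewrite !scale1r -[X in (X - _)%MM]add0m addmK mpolyX0 mul1r.
Qed.

Lemma dYY k l f : dY k (Y l * f) + Y l * dY k f = (k == l)%:R *: f.
Proof.
have sq (x : nat) (p : {mpoly F[m.-1]}) : (-1) ^+ x * ((-1) ^+ x * p) = p.
  by rewrite mulrA -exprD addnn -mul2n exprM sqrrN expr1n expr1n mul1r.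
apply/ffunP => A; rewrite ffunE [X in X + _]ffunE !mulYE !ffunE.
have [->|nkl] := eqVneq k l.
  rewrite scale1r !inE eqxx /=; case: ifPn => lA; last by rewrite setU1K // sq addr0.
  by rewrite setD1K // sq add0r.
rewrite scale0r !inE nkl eq_sym (negPf nkl) /=.
case: ifPn => kA; first by rewrite mulr0 if_same addr0.
case: ifPn => lA; last by rewrite mulr0 addr0.
have E : (k |: A) :\ l = k |: (A :\ l).
  apply/setP => a; rewrite !inE; case: eqP => // ->.
  by rewrite eq_sym (negPf nkl).
rewrite E -{1}(setD1K lA) !inversionsUr; last 2 first.
- by rewrite disjoints1 !inE (negPf kA) andbF.
- by rewrite disjoints1 !inE eqxx.
rewrite !exprD (sign_inversions1 nkl) !mulNr -[X in - X + _]mulrA.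
rewrite -mulrA [X in - (_ * X)]mulrCA sq.
by rewrite mulrCA addNr.
Qed.

End Algebra.

From mathcomp Require Import boolp classical_sets fsbigop.
Local Open Scope classical_set_scope.

(* From here on indices are 1-based natural numbers.  [x_ i] is meaningful for
   2 <= i <= m and [y_ k] for 1 <= k <= n; outside these ranges the generators
   and the derivatives are 0. *)
Section Module.
Variables (F : fieldType) (m n : nat).
Local Notation W := (W F m n).

Definition x_ (i : nat) : W := \sum_(j < m.-1 | j.+2 == i) X F n j.
Definition y_ (k : nat) : W := \sum_(l < n | l.+1 == k) Y F m l.
Definition dx (i : nat) (w : W) : W := \sum_(j < m.-1 | j.+2 == i) dX j w.
Definition dy (k : nat) (w : W) : W := \sum_(l < n | l.+1 == k) dY l w.

Definition gen (i : nat) : W := if (i <= m)%N then x_ i else y_ (i - m).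
Definition der (i : nat) : W -> W := if (i <= m)%N then dx i else dy (i - m).

Definition e11 (mu : F) (w : W) : W :=
  mu *: w - \sum_(2 <= s < m.+1) x_ s * dx s w
          - \sum_(1 <= t < n.+1) y_ t * dy t w.

Definition e_ (mu : F) (i j : nat) (w : W) : W :=
  match i == 1%N, j == 1%N with
  | true,  true  => e11 mu w
  | false, true  => gen i * w
  | true,  false => e11 mu (der j w)
  | false, false => gen i * der j w
  end.

Definition act (mu : F) (A : 'M[F]_(m + n)) (w : W) : W :=
  \sum_(i < m + n) \sum_(j < m + n) A i j *: e_ mu i.+1 j.+1 w.

Definition gl (mu : F) : set (W -> W) := range (act mu).

Definition odd_index (i : nat) : bool := (m < i)%N.

(* the homogeneous components (true = odd) of the Lie subsuperalgebra of gl(W)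
   generated by the e_{i,j} with 2 <= i, j <= m + n *)
Inductive S_hom (mu : F) : bool -> (W -> W) -> Prop :=
| S_gen i j : (2 <= i <= m + n)%N -> (2 <= j <= m + n)%N ->
    S_hom mu (odd_index i (+) odd_index j) (e_ mu i j)
| S_zero b : S_hom mu b (fun=> 0)
| S_lin b (c : F) f g : S_hom mu b f -> S_hom mu b g ->
    S_hom mu b (fun w => c *: f w + g w)
| S_bracket b b' f g : S_hom mu b f -> S_hom mu b' g ->
    S_hom mu (b (+) b') (fun w => f (g w) - (-1) ^+ (b && b') *: g (f w)).

Definition Salg (mu : F) : set (W -> W) :=
  [set T | exists f g, [/\ S_hom mu false f, S_hom mu true g &
                           T = fun w => f w + g w]].

Definition subspace (U : set W) : Prop :=
  U 0 /\ forall (c : F) u v, U u -> U v -> U (c *: u + v).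

Definition submodule (L : set (W -> W)) (U : set W) : Prop :=
  subspace U /\ forall T u, L T -> U u -> U (T u).

Definition generated (L : set (W -> W)) (v : W) : set W :=
  [set w | forall U, submodule L U -> U v -> U w].

Definition irreducible (L : set (W -> W)) (U : set W) : Prop :=
  [/\ submodule L U, U <> [set 0] &
      forall N, submodule L N -> N `<=` U -> N = [set 0] \/ N = U].

(* monomials of degree s: x-degree plus number of y's *)
Definition Wdeg (s : nat) : set W :=
  [set w | forall (A : {set 'I_n}) c, c \in msupp ((w : W) A) -> (mdeg c + #|A|)%N = s].

Definition V (k : nat) : set W :=
  if (2 <= m)%N then generated (gl k%:R) (x_ 2 ^+ k.+1)
  else if (k < n)%N then generated (gl k%:R) (\prod_(1 <= i < k.+2) y_ i)
  else [set 0].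

(* A linear form l on the diagonal matrices (of gl_{m|n}, resp. of S) is given
   by its coordinates in the basis of the epsilon_i; column j corresponds to
   epsilon_{j+1}, resp. epsilon_{j+2}. *)
Definition pairing (N : nat) (l h : 'rV[F]_N) : F := \sum_(i < N) l 0 i * h 0 i.

Definition eps (i : nat) : 'rV[F]_(m + n) := \row_j (j.+1 == i)%:R.
Definition epsS (i : nat) : 'rV[F]_(m + n).-1 := \row_j (j.+2 == i)%:R.
Definition alpha (i : nat) : 'rV[F]_(m + n) := eps i - eps i.+1.

Definition weight_space (mu : F) (M : set W) (l : 'rV[F]_(m + n)) : set W :=
  [set w | M w /\ forall h, act mu (diag_mx h) w = pairing l h *: w].

Definition has_dim (U : set W) (d : nat) : Prop :=
  exists b : 'I_d -> W,
    (forall c : 'I_d -> F, \sum_i c i *: b i = 0 -> forall i, c i = 0) /\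
    U = [set \sum_i c i *: b i | c in [set: 'I_d -> F]].

Definition finite_dim (U : set W) : Prop := exists d, has_dim U d.

(* 0 when U is not finite-dimensional *)
Definition dim (U : set W) : nat := xget 0%N [set d | has_dim U d].

Definition weight_module (mu : F) (M : set W) : Prop :=
  forall w, M w -> exists d (l : 'I_d -> 'rV[F]_(m + n)) (u : 'I_d -> W),
    (forall i, weight_space mu M (l i) (u i)) /\ w = \sum_i u i.

(* Formal, possibly infinite, combinations of the e(lambda), as families of
   coefficients. *)
Definition formal_char := 'rV[F]_(m + n) -> nat.

Definition fexp (l : 'rV[F]_(m + n)) : formal_char := fun l' => (l' == l : nat).

Definition formal_sum (A : set 'rV[F]_(m + n))
    (f : 'rV[F]_(m + n) -> formal_char) : formal_char :=
  fun l => \big[addn/0%N]_(a \in A) f a l.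

Definition Ch (mu : F) (M : set W) : formal_char :=
  fun l => dim (weight_space mu M l).

(* M is a weight module with finite-dimensional weight spaces, and chi is its
   character *)
Definition has_character (mu : F) (M : set W) (chi : formal_char) : Prop :=
  [/\ weight_module mu M, forall l, finite_dim (weight_space mu M l) &
      Ch mu M = chi].

(* only t 1, ..., t (m + n) matter *)
Definition admissible (t : nat -> int) : Prop :=
  [/\ forall i, (1 <= i < m + n)%N -> t i.+1 <= t i,
      t (m + n)%N = 0 &
      forall j, (m <= j < m + n)%N -> t j - t j.+1 \in [:: 0; 1]].

Definition comb (t : nat -> int) : 'rV[F]_(m + n) :=
  \sum_(1 <= i < m + n) (- t i)%:~R *: alpha i.

Definition P : set 'rV[F]_(m + n) := [set comb t | t in admissible].

Definition Q (k : nat) : set 'rV[F]_(m + n) :=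
  [set comb t | t in [set t | admissible t /\ k.+1%:Z <= t 1%N]].

Definition highest_weight_vector (mu : F) (U : set W) (v : W)
    (l : 'rV[F]_(m + n).-1) : Prop :=
  [/\ v != 0,
      forall h : 'rV[F]_(m + n).-1,
        \sum_(i < (m + n).-1) h 0 i *: e_ mu i.+2 i.+2 v = pairing l h *: v,
      forall i j, (2 <= i)%N -> (i < j)%N -> (j <= m + n)%N -> e_ mu i j v = 0 &
      generated (Salg mu) v = U].

End Module.

Arguments x_ : clear implicits.
Arguments y_ : clear implicits.
Arguments Wdeg : clear implicits.
Arguments V : clear implicits.
Arguments eps : clear implicits.
Arguments epsS : clear implicits.
Arguments P : clear implicits.
Arguments Q : clear implicits.
Arguments Salg {F} m n mu.

(* Main.v *)
(* W has a basis of monomials x^c y_A.  Each of them is a weight vector, and the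
   weights are pairwise distinct because the e_{i,i} with i >= 2 read off the
   exponents; this gives the characters once V(mu) is known to be spanned by the
   monomials of degree > mu.  For the same reason a subspace stable under the
   e_{i,i} contains every monomial component of its elements, and the e_{i,j}
   with i, j >= 2 lead, up to nonzero scalars, from any monomial to any other one
   of the same degree; hence W_s is irreducible.  Finally e_{1,j} sends a
   monomial of degree d to a multiple of mu - (d - 1) times one of degree d - 1, so
   that the part of W of degree > mu is a submodule when mu is a natural number,
   and multiplication by the generators recovers it from its lowest component. *)

Require Import Defs.
From mathcomp Require Import all_boot all_order all_algebra.
From mathcomp Require Import mpoly.
From mathcomp Require Import boolp classical_sets fsbigop reals complex.

Import GRing.Theory Num.Theory.
Local Open Scope ring_scope.
Local Open Scope classical_set_scope.
Local Open Scope complex_scope.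

Set Implicit Arguments.
Unset Strict Implicit.
Unset Printing Implicit Defensive.

(** * Monomials *)

Section Monomials.
Variables (F : fieldType) (p n : nat).
Local Notation W := (W F p.+1 n).
Local Notation mon := ('X_{1..p} * {set 'I_n})%type.
Implicit Types (M : mon) (w : W) (i j : 'I_(p + n)) (q : pred mon) (U : set W).

(* The pair (c, A) stands for the monomial x^c y_A. *)
Definition mono M : W := [ffun A : {set 'I_n} => if A == M.2 then 'X_[M.1] else 0].

Definition coef w M : F := ((w : {ffun _ -> _}) M.2)@_(M.1).

Lemma coefD (c : F) u v M : coef (c *: u + v) M = c * coef u M + coef v M.
Proof. by rewrite /coef !ffunE mcoeffD mcoeffZ. Qed.

Lemma coef0 M : coef 0 M = 0.
Proof. by rewrite /coef ffunE mcoeff0. Qed.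

Lemma coefZ (c : F) w M : coef (c *: w) M = c * coef w M.
Proof. by rewrite -[c *: w]addr0 coefD coef0 addr0. Qed.

Lemma coef_mono M M' : coef (mono M) M' = (M == M')%:R.
Proof.
rewrite /coef ffunE; case: M M' => [c A] [c' A'] /=; rewrite xpair_eqE [A == _]eq_sym.
by case: eqP => _; rewrite ?andbT ?andbF ?mcoeff0 // mcoeffX.
Qed.

Lemma coef_inj u v : coef u =1 coef v -> u = v.
Proof.
by move=> E; apply/ffunP => A; apply/mpolyP => c; have := E (c, A).
Qed.

Lemma mono_neq0 M : mono M != 0.
Proof.
by apply/eqP => /(congr1 (coef^~ M))/eqP; rewrite coef_mono eqxx coef0 oner_eq0.
Qed.

Definition supp w : seq mon :=
  [seq (c, A) | A <- enum {set 'I_n}, c <- msupp ((w : {ffun _ -> _}) A)].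

Lemma coef_neq0 w M : (coef w M != 0) = (M \in supp w).
Proof.
rewrite -mcoeff_msupp; apply/idP/allpairsPdep => [cM|[A [c [_ cA ->]]]] //.
by exists M.2, M.1; rewrite mem_enum -surjective_pairing.
Qed.

Lemma monoE w : w = \sum_(M <- supp w) coef w M *: mono M.
Proof.
apply/ffunP => A; rewrite sum_ffunE big_allpairs_dep /= (bigD1_seq A) ?mem_enum ?enum_uniq //=.
rewrite [X in _ + X]big1 ?addr0 => [|B nBA]; last first.
  by apply: big1 => c _; rewrite !ffunE /= eq_sym (negPf nBA) scaler0.
by rewrite {1}[_ A]mpolyE; apply: eq_bigr => c _; rewrite !ffunE /= eqxx.
Qed.

(** * Subspaces of [W] and linear operators on it *)

Lemma subspaceZ U (c : F) w : subspace U -> U w -> U (c *: w).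
Proof. by case=> U0 US Uw; rewrite -[c *: w]addr0; exact: US. Qed.

Lemma subspace_sum (I : Type) (r : seq I) (P : pred I) (f : I -> W) U :
  subspace U -> (forall x, P x -> U (f x)) -> U (\sum_(x <- r | P x) f x).
Proof.
move=> [U0 US] Uf; elim/big_rec: _ => // x u Px Uu.
by rewrite -[f x]scale1r; apply: US => //; exact: Uf.
Qed.

Lemma subspace_span U w :
  subspace U -> (forall M, coef w M != 0 -> U (mono M)) -> U w.
Proof.
move=> sU Uw; rewrite [w]monoE big_seq; apply: subspace_sum => // M.
by rewrite -coef_neq0 => /Uw; exact: subspaceZ.
Qed.

Definition lin (T : W -> W) := forall c u v, T (c *: u + v) = c *: T u + T v.

Lemma lin_comp T T' : lin T -> lin T' -> lin (T \o T').
Proof. by move=> lT lT' c u v; rewrite /= lT' lT. Qed.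

Lemma linZ T c w : lin T -> T (c *: w) = c *: T w.
Proof.
move=> lT; have T0 : T 0 = 0.
  by have := lT (-1) 0 0; rewrite scaler0 addr0 scaleN1r addNr.
by rewrite -[c *: w]addr0 lT T0 addr0.
Qed.

Lemma lin_sum (I : Type) (r : seq I) (P : pred I) (f : I -> W -> W) :
  (forall x, lin (f x)) -> lin (fun w => \sum_(x <- r | P x) f x w).
Proof.
move=> lf c u v; rewrite scaler_sumr -big_split /=.
by apply: eq_bigr => i _; rewrite lf.
Qed.

Lemma lin_scale c T : lin T -> lin (fun w => c *: T w).
Proof. by move=> lT d u v; rewrite lT scalerDr !scalerA mulrC. Qed.

Lemma lin_sub T T' : lin T -> lin T' -> lin (fun w => T w - T' w).
Proof.
by move=> lT lT' c u v; rewrite lT lT' opprD addrACA -scalerBr.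
Qed.

Lemma lin_mul (g : W) : lin (fun w => g * w).
Proof. by move=> c u v; rewrite mulrDr scalerAr. Qed.

(** Reduces stability of a subspace under an operator to a computation on monomials. *)
Lemma lin_stable T U q : lin T -> subspace U -> (forall M, q M -> U (T (mono M))) ->
  forall w, (forall M, coef w M != 0 -> q M) -> U (T w).
Proof.
move=> lT [U0 US] Uq w qw; apply: (@subspace_span [set u | U (T u)]); last first.
  by move=> M /qw/Uq.
split=> [|c u v Uu Uv] /=; last by rewrite lT; exact: US.
by rewrite -(scale0r (0 : W)) linZ // scale0r.
Qed.

(* With m = p.+1, i : 'I_(p + n) stands for the index i + 2 of the paper, i.e.
   for x_(i+2) when i < p and for y_(i-p+1) otherwise. *)
Definition G i : W :=
  match split i with inl a => @X F p.+1 n a | inr k => Y F p.+1 k end.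

Definition D i : W -> W :=
  match split i with inl a => @dX F p.+1 n a | inr k => dY k end.

Definition mult M i : nat :=
  match split i with inl a => M.1 a | inr k => k \in M.2 end.

Definition odd_gen i : bool := (p <= i)%N.

(** For an odd variable already present, [incr] returns M unchanged; for an absent variable, [decr]
    does. The true product or derivative is then 0, which is recorded by the coefficients [gcoef]
    and [dcoef]. *)
Definition incr i M : mon :=
  match split i with
  | inl a => ((U_(a) + M.1)%MM, M.2) | inr k => (M.1, k |: M.2) end.

Definition decr i M : mon :=
  match split i with
  | inl a => ((M.1 - U_(a))%MM, M.2) | inr k => (M.1, M.2 :\ k) end.

(** The sign as a scalar of F, whereas [mulYE] and [dY] have it in the polynomial ring; [sgnE]
    passes from one to the other. *)
Definition sgn (k : 'I_n) (A : {set 'I_n}) : F := (-1) ^+ inversions [set k] A.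

Lemma sgn_neq0 k A : sgn k A != 0.
Proof. by rewrite signr_eq0. Qed.

Lemma sgnE k A (f : {mpoly F[p.+1.-1]}) :
  (-1) ^+ inversions [set k] A * f = sgn k A *: f.
Proof. by rewrite /sgn -signr_odd -[in RHS]signr_odd mulr_sign scaler_sign. Qed.

Definition gcoef i M : F :=
  match split i with
  | inl a => 1 | inr k => if k \in M.2 then 0 else sgn k M.2 end.

Definition dcoef i M : F :=
  match split i with
  | inl a => (M.1 a)%:R | inr k => if k \in M.2 then sgn k (M.2 :\ k) else 0 end.

Lemma G_mono i M : G i * mono M = gcoef i M *: mono (incr i M).
Proof.
rewrite /G /gcoef /incr; case: (split i) => [a|k]; apply/ffunP => A.
  rewrite mulXE !ffunE /=; case: eqP => _; last by rewrite mulr0 scaler0.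
  by rewrite -mpolyXD scale1r.
rewrite mulYE !ffunE /=.
have [kM|kM] := boolP (k \in M.2).
  rewrite scale0r; case: ifP => // _; case: eqP => [E|_]; last by rewrite mulr0.
  by move: kM; rewrite -E !inE eqxx.
have E : (A == k |: M.2) = (k \in A) && (A :\ k == M.2).
  apply/eqP/andP => [->|[kA /eqP <-]]; last by rewrite finset.setD1K.
  by rewrite finset.setU11 finset.setU1K.
rewrite E; case: (k \in A) => /=; last by rewrite scaler0.
by case: eqP => [->|_]; rewrite ?mulr0 ?scaler0 // sgnE.
Qed.

Lemma D_mono i M : D i (mono M) = dcoef i M *: mono (decr i M).
Proof.
rewrite /D /dcoef /decr; case: (split i) => [a|k]; apply/ffunP => A.
  rewrite !ffunE /=; case: eqP => _; last by rewrite raddf0 scaler0.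
  by rewrite mderivX.
rewrite !ffunE /=.
have [kM|kM] := boolP (k \in M.2); last first.
  rewrite scale0r; case: ifP => // _; case: eqP => [E|_]; last by rewrite mulr0.
  by move: kM; rewrite -E finset.setU11.
have E : (A == M.2 :\ k) = (k \notin A) && (k |: A == M.2).
  apply/eqP/andP => [->|[kA /eqP <-]]; last by rewrite finset.setU1K.
  by rewrite finset.setD1K // !inE eqxx.
rewrite E; case: (boolP (k \in A)) => kA /=; first by rewrite scaler0.
by case: eqP => [<-|_]; rewrite ?mulr0 ?scaler0 // sgnE finset.setU1K.
Qed.

Lemma split_eq i j : (split i == split j) = (i == j).
Proof. by rewrite (can_eq splitK). Qed.

Lemma odd_genP i : reflect (exists k, split i = inr k) (odd_gen i).
Proof.
rewrite /odd_gen; case: (ltnP i p) => [lt|le]; constructor.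
  by case; case: splitP => // k E; have := lt; rewrite E ltnNge leq_addr.
by case: splitP => [a E|k _]; [have := ltn_ord a; rewrite -E ltnNge le|exists k].
Qed.

Lemma mult_odd i M : odd_gen i -> (mult M i <= 1)%N.
Proof. by case/odd_genP => k E; rewrite /mult E leq_b1. Qed.

Lemma mult_decr i j M : mult (decr i M) j = (mult M j - (i == j))%N.
Proof.
rewrite -split_eq /mult /decr; case: (split i) => a; case: (split j) => b //=;
  rewrite ?subn0 //.
  by rewrite mnmBE mnm1E.
rewrite !inE (inj_eq (@inr_inj _ _)) [a == b]eq_sym.
by case: eqP; case: (_ \in _).
Qed.

(** The side condition says that the product of the i-th generator with M does not vanish; see
    [gcoef_neq0]. *)
Lemma mult_incr i j M : ~~ odd_gen i || (mult M i == 0%N) ->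
  mult (incr i M) j = (mult M j + (i == j))%N.
Proof.
rewrite -split_eq /mult /incr; case: odd_genP => [[k ->]|].
  rewrite /= eqb0 => kM; case: (split j) => b //=; rewrite ?addn0 // !inE.
  rewrite (inj_eq (@inr_inj _ _)) [k == b]eq_sym.
  by case: eqP => [->|]; rewrite ?(negPf kM) ?addn0.
case: (split i) => [a _ _|k []]; last by exists k.
case: (split j) => b; rewrite /= ?addn0 //.
by rewrite mnmDE mnm1E addnC.
Qed.

Lemma mult_inj M M' : mult M =1 mult M' -> M = M'.
Proof.
case: M M' => [c A] [c' A'] E; congr (_, _).
  apply/mnmP => a; have := E (unsplit (inl a)).
  by rewrite /mult unsplitK.
apply/setP => k; have := E (unsplit (inr k)).
by rewrite /mult unsplitK /=; do 2 case: (_ \in _).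
Qed.

Definition deg M : nat := \sum_i mult M i.

Lemma degE M : deg M = (mdeg M.1 + #|M.2|)%N.
Proof.
rewrite /deg big_split_ord /= mdegE; congr addn.
  by apply: eq_bigr => a _; rewrite /mult (unsplitK (inl a)).
rewrite -sum1_card [RHS]big_mkcond /=; apply: eq_bigr => k _.
by rewrite /mult (unsplitK (inr k)); case: (_ \in _).
Qed.

Lemma deg_decr i M : (0 < mult M i)%N -> deg M = (deg (decr i M)).+1.
Proof.
move=> Mi; rewrite /deg (bigD1 i) //= [in RHS](bigD1 i) //= mult_decr eqxx -addSn.
rewrite subn1 prednK //; congr addn; apply: eq_bigr => j; rewrite eq_sym mult_decr.
by move=> /negPf->; rewrite subn0.
Qed.

Lemma decr_incr i M : ~~ odd_gen i || (mult M i == 0%N) -> decr i (incr i M) = M.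
Proof.
by move=> Mi; apply: mult_inj => j; rewrite mult_decr mult_incr // addnK.
Qed.

(** An odd exponent is at most 1, so lowering it leaves 0 and the variable can always be multiplied
    back. *)
Lemma mult_decr_odd i M : ~~ odd_gen i || (mult (decr i M) i == 0%N).
Proof.
rewrite mult_decr eqxx; case: (boolP (odd_gen i)) => //= /(mult_odd M).
by rewrite -subn_eq0.
Qed.

Lemma incr_decr i M : (0 < mult M i)%N -> incr i (decr i M) = M.
Proof.
move=> Mi; apply: mult_inj => j; rewrite mult_incr ?mult_decr_odd // mult_decr.
by case: eqP => [<-|_]; rewrite ?subnK // subn0 addn0.
Qed.

Lemma deg_incr i M : ~~ odd_gen i || (mult M i == 0%N) -> deg (incr i M) = (deg M).+1.
Proof.
by move=> Mi; rewrite (@deg_decr i) ?decr_incr // mult_incr // eqxx addn1.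
Qed.

Lemma gcoef_neq0 i M : (gcoef i M != 0) = ~~ odd_gen i || (mult M i == 0%N).
Proof.
rewrite /gcoef /mult; case: odd_genP => [[k ->]|].
  by rewrite eqb0; case: (_ \in _); rewrite ?eqxx // sgn_neq0.
by case: (split i) => [a _|k []]; [rewrite oner_eq0|exists k].
Qed.

Lemma dcoef0 i M : mult M i = 0%N -> dcoef i M = 0.
Proof.
by rewrite /dcoef /mult; case: (split i) => [a ->|k] //; case: (_ \in _).
Qed.

(** Removing an odd variable and putting it back produces the same sign twice, so the diagonal
    operators read off exponents without sign. *)
Lemma dcoefE i M : gcoef i (decr i M) * dcoef i M = (mult M i)%:R.
Proof.
rewrite /gcoef /dcoef /mult /decr; case: (split i) => [a|k]; first by rewrite mul1r.
rewrite !inE eqxx /=; case: (_ \in _); last by rewrite mulr0.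
by rewrite /sgn -exprMn mulrNN mulr1 expr1n.
Qed.

Lemma GD_mono i M : G i * D i (mono M) = (mult M i)%:R *: mono M.
Proof.
rewrite D_mono -scalerAr G_mono scalerA mulrC dcoefE.
have [->|Mi] := posnP (mult M i); first by rewrite !scale0r.
by rewrite incr_decr.
Qed.

Lemma lin_D i : lin (D i).
Proof.
rewrite /D; case: (split i) => k c u v; apply/ffunP => A; rewrite !ffunE.
  by rewrite mderivD mderivZ.
case: ifP => _; first by rewrite scaler0 addr0.
by rewrite mulrDr scalerAr.
Qed.


(** * The action on monomials *)

Lemma genE i : gen F p.+1 n i.+2 = G i.
Proof.
rewrite /gen /G ltnS; case: splitP => [a ->|k ->]; first by rewrite /x_ (big_pred1 a).
by rewrite subSS -addnS addKn /y_ (big_pred1 k).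
Qed.

Lemma derE i : @der F p.+1 n i.+2 = D i.
Proof.
apply: funext => w; rewrite /der /D ltnS.
case: splitP => [a ->|k ->]; first by rewrite /dx (big_pred1 a).
by rewrite subSS -addnS addKn /dy (big_pred1 k).
Qed.

Lemma e11E mu w : e11 mu w = mu *: w - \sum_i G i * D i w.
Proof.
rewrite /e11 -addrA -opprD; congr (_ - _).
(* The ranges 2..m and 1..n are shifted to start at 0 and glued into one sum over all generators. *)
rewrite big_split_ord big_add1 big_add1 [in X in _ + X = _]big_add1 /= !big_mkord.
congr (_ + _); apply: eq_bigr => a _; rewrite /G /D.
  by rewrite (unsplitK (inl a)) /x_ /dx !(big_pred1 a).
by rewrite (unsplitK (inr a)) /y_ /dy !(big_pred1 a).
Qed.

Lemma e11_mono mu M : e11 mu (mono M) = (mu - (deg M)%:R) *: mono M.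
Proof.
rewrite e11E scalerBl; congr (_ - _).
under eq_bigr => i _ do rewrite GD_mono.
by rewrite -scaler_suml -natr_sum.
Qed.

Lemma lin_GD i j : lin (fun w => G i * D j w).
Proof. exact: lin_comp (@lin_mul _) (@lin_D _). Qed.

Lemma lin_e11 mu : lin (e11 mu).
Proof.
have -> : e11 mu = fun w => mu *: w - \sum_i G i * D i w.
  by apply: funext => w; rewrite e11E.
apply: lin_sub; first exact: lin_scale.
by apply: lin_sum => i; exact: lin_GD.
Qed.

Lemma e_E mu i j w : e_ mu i.+2 j.+2 w = G i * D j w.
Proof. by rewrite /e_ /= genE derE. Qed.

Lemma e_G mu i w : e_ mu i.+2 1 w = G i * w.
Proof. by rewrite /e_ /= genE. Qed.

Lemma e_D mu i w : e_ mu 1 i.+2 w = e11 mu (D i w).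
Proof. by rewrite /e_ /= derE. Qed.

(** * Spans of monomials and stability under the two algebras *)

Definition span_of q : set W := [set w | forall M, coef w M != 0 -> q M].

Lemma subspace_span_of q : subspace (span_of q).
Proof.
split=> [M|c u v Uu Uv M]; first by rewrite coef0 eqxx.
rewrite coefD; have [u0|/Uu //] := eqVneq (coef u M) 0.
by rewrite u0 mulr0 add0r; exact: Uv.
Qed.

Lemma span_of_mono q M : q M -> span_of q (mono M).
Proof.
by move=> qM M'; rewrite coef_mono; case: (eqVneq M M') => [<-|_]; rewrite ?eqxx.
Qed.

Lemma span_of_sub q U : subspace U -> (forall M, q M -> U (mono M)) -> span_of q `<=` U.
Proof. by move=> sU Uq w qw; apply: subspace_span => // M /qw/Uq. Qed.

Lemma WdegE s : Wdeg F p.+1 n s = span_of (fun M => deg M == s).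
Proof.
apply/seteqP; split=> w /= ws.
  by move=> M; rewrite -mcoeff_msupp => /ws; rewrite degE => ->.
move=> A c; rewrite mcoeff_msupp => /(ws (c, A)); rewrite degE => /eqP//.
Qed.

(** A superbracket is a linear combination of the two composites, so stability passes from the
    generators to all of [S] by induction. *)
Lemma Salg_stable mu U : subspace U ->
  (forall i j w, U w -> U (G i * D j w)) -> submodule (Salg p.+1 n mu) U.
Proof.
move=> sU Ue; split=> // T u [f [g [Sf Sg ->]]] Uu.
have S_stable b h : S_hom mu b h -> forall w, U w -> U (h w).
  elim=> {b h} [i j|b|b c h k _ Uh _ Uk|b b' h k _ Uh _ Uk].
  - case: i => [|[|i]] //; case: j => [|[|j]] // /andP[_ li] /andP[_ lj] w Uw.
    rewrite (e_E mu (Ordinal (li : (i < p + n)%N)) (Ordinal (lj : (j < p + n)%N))).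
    exact: Ue.
  - by move=> w _; exact: sU.1.
  - by move=> w Uw; apply: sU.2; [exact: Uh|exact: Uk].
  - move=> w Uw; rewrite addrC -scaleNr; apply: sU.2; last exact/Uh/Uk.
    exact/Uk/Uh.
by rewrite -[f u]scale1r; apply: sU.2; [exact: S_stable Sf _ Uu|exact: S_stable Sg _ Uu].
Qed.

Lemma Salg_GD mu i j : Salg p.+1 n mu (fun w => G i * D j w).
Proof.
have -> : (fun w => G i * D j w) = e_ mu i.+2 j.+2 by apply: funext => w; rewrite e_E.
have : S_hom mu (odd_index p.+1 i.+2 (+) odd_index p.+1 j.+2)
    (@e_ F p.+1 n mu i.+2 j.+2).
  by apply: S_gen; apply/andP; split=> //; exact: ltn_ord.
(* The parity of the generator decides which homogeneous component it fills; the other one is 0. *)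
case: (_ (+) _) => S_e;
  [exists (fun=> 0), (e_ mu i.+2 j.+2)|exists (e_ mu i.+2 j.+2), (fun=> 0)];
  split=> //; try exact: S_zero; apply: funext => w; rewrite ?add0r ?addr0 //.
Qed.

Lemma act_delta mu (i j : 'I_(p.+1 + n)) w :
  @act F p.+1 n mu (delta_mx i j) w = @e_ F p.+1 n mu i.+1 j.+1 w.
Proof.
rewrite /act (bigD1 i) //= (bigD1 j) //= !big1 ?addr0 => [|i' ni|j' nj].
- by rewrite mxE !eqxx scale1r.
- by apply: big1 => j' _; rewrite mxE (negPf ni) scale0r.
- by rewrite mxE (negPf nj) andbF scale0r.
Qed.

Lemma gl_stable mu U : subspace U ->
  (forall i j w, U w -> U (G i * D j w)) -> (forall i w, U w -> U (G i * w)) ->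
  (forall i w, U w -> U (e11 mu (D i w))) -> (forall w, U w -> U (e11 mu w)) ->
  submodule (@gl F p.+1 n mu) U.
Proof.
move=> sU UGD UG UeD Ue; split=> // _ u [A _ <-] Uu.
apply: subspace_sum => // i _; apply: subspace_sum => // j _; apply: subspaceZ => //.
case: i j => [[|i] li] [[|j] lj] /=.
- exact: Ue.
- by rewrite (e_D mu (Ordinal (lj : (j < p + n)%N))); exact: UeD.
- by rewrite (e_G mu (Ordinal (li : (i < p + n)%N))); exact: UG.
- rewrite (e_E mu (Ordinal (li : (i < p + n)%N)) (Ordinal (lj : (j < p + n)%N))).
  exact: UGD.
Qed.

Lemma gl_e_ mu U (i j : nat) w : submodule (@gl F p.+1 n mu) U -> (i <= p + n)%N ->
  (j <= p + n)%N -> U w -> U (@e_ F p.+1 n mu i.+1 j.+1 w).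
Proof.
move=> [_ US] li lj Uw.
pose i' : 'I_(p.+1 + n) := Ordinal (li : (i < p.+1 + n)%N).
pose j' : 'I_(p.+1 + n) := Ordinal (lj : (j < p.+1 + n)%N).
have /= <- := act_delta mu i' j' w.
by apply: (US (act mu _)) => //; exists (delta_mx i' j').
Qed.


Lemma GD_mono2 i j M : G i * D j (mono M) =
  (dcoef j M * gcoef i (decr j M)) *: mono (incr i (decr j M)).
Proof. by rewrite D_mono -scalerAr G_mono scalerA. Qed.

Lemma coef_diag T (e : mon -> F) w M : lin T ->
  (forall M', T (mono M') = e M' *: mono M') -> coef (T w) M = e M * coef w M.
Proof.
move=> lT Te; apply: (@subspace_span [set w | coef (T w) M = e M * coef w M]).
  split=> [|c u v /= Eu Ev]; last by rewrite lT !coefD Eu Ev mulrDr mulrCA.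
  by rewrite /= -(scale0r (0 : W)) linZ // !coefZ !mul0r mulr0.
move=> M' _ /=; rewrite Te coefZ coef_mono.
by case: eqVneq => [->|]; rewrite ?mulr0.
Qed.

Hypothesis charF : [pchar F] =i pred0.

Lemma natr_eq0F k : (k%:R == 0 :> F) = (k == 0%N).
Proof. exact: (pcharf0P _).1. Qed.

(** Distinct exponents give distinct eigenvalues of the diagonal operators: characteristic 0 enters
    here. *)
Lemma natr_injF : injective (fun k : nat => k%:R : F).
Proof.
move=> a b /=; wlog le_ab : a b / (a <= b)%N => [H|/eqP].
  by case: (leqP a b) => [|/ltnW] le E; [|symmetry]; apply: H.
rewrite eq_sym -subr_eq0 -natrB // natr_eq0F subn_eq0 => le_ba.
by apply/eqP; rewrite eqn_leq le_ab.
Qed.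

(** * Submodules and irreducibility *)

(* A monomial N other than M is removed from the support of w by some
   e_{i,i} - mult N i, rescaled so as to preserve the coefficient of M. *)
Lemma mono_component U w M : subspace U ->
  (forall i w, U w -> U (G i * D i w)) -> U w -> U (coef w M *: mono M).
Proof.
move=> sU Ue Uw.
(* Induction on a list containing every monomial of w except possibly M. *)
have: forall N, coef w N != 0 -> N = M \/ N \in supp w.
  by move=> N; rewrite coef_neq0; right.
move: (supp w) => s; elim: s w Uw => [|N s IHs] w Uw suppw.
  rewrite (_ : _ *: _ = w) //; apply: coef_inj => N; rewrite coefZ coef_mono.
  have [<-|neqN] := eqVneq M N; first by rewrite mulr1.
  rewrite mulr0; apply/esym/eqP; apply: contraT => /suppw[E|//].
  by rewrite E eqxx in neqN.
have [EN|neqN] := eqVneq N M.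
  by apply: IHs => // N' /suppw; rewrite inE EN => -[->|/orP[/eqP->|]]; auto.
have [i neqi] : exists i, mult M i != mult N i.
  apply/existsP; apply: contraNT neqN; rewrite negb_exists => /forallP E.
  by apply/eqP/mult_inj => i; have := E i; rewrite negbK => /eqP.
pose a : F := (mult M i)%:R - (mult N i)%:R.
have a0 : a != 0 by rewrite subr_eq0; apply: contraNN neqi => /eqP/natr_injF->.
pose w' := a^-1 *: (G i * D i w) + (- (mult N i)%:R / a) *: w.
have coefw' N' : coef w' N' = a^-1 * ((mult N' i)%:R - (mult N i)%:R) * coef w N'.
  rewrite coefD coefZ (coef_diag _ _ (lin_GD i i) (GD_mono i)).
  by rewrite mulrA -mulrDl [_ / a]mulrC -mulrDr.
have -> : coef w M = coef w' M by rewrite coefw' mulVf // mul1r.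
apply: IHs => [|N'].
  by apply: sU.2; [exact: Ue|exact: subspaceZ].
rewrite coefw' !mulf_eq0 !negb_or => /andP[/andP[_ neq] /suppw[->|]]; first by left.
rewrite inE => /orP[/eqP E|]; last by right.
by rewrite E subrr eqxx in neq.
Qed.

Lemma dcoef_neq0 i M : (0 < mult M i)%N -> dcoef i M != 0.
Proof.
move=> Mi; have : gcoef i (decr i M) * dcoef i M != 0.
  by rewrite dcoefE natr_eq0F -lt0n.
by rewrite mulf_eq0 negb_or => /andP[].
Qed.

Lemma mono_scaled U c M : subspace U -> c != 0 -> U (c *: mono M) -> U (mono M).
Proof.
by move=> sU c0 /(@subspaceZ _ c^-1 _ sU); rewrite scalerA mulVf // scale1r.
Qed.

Lemma sumn_lt (I : finType) (f g : I -> nat) x :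
  (forall y, f y <= g y)%N -> (f x < g x)%N -> (\sum_y f y < \sum_y g y)%N.
Proof.
move=> le lt; rewrite (bigD1 x) //= [in ltnRHS](bigD1 x) //= -addSn.
by apply: leq_add => //; apply: leq_sum.
Qed.

(** Otherwise M would dominate M' in every exponent, and equal degrees would force equality. *)
Lemma mult_lt_ex M M' : deg M = deg M' -> M != M' ->
  exists i, (mult M i < mult M' i)%N.
Proof.
move=> degM; apply: contraNP => /forallNP ge_M; apply/eqP/mult_inj => i.
have {}ge_M k : (mult M' k <= mult M k)%N by rewrite leqNgt; apply/negP/ge_M.
apply/eqP; rewrite eqn_leq ge_M andbT leqNgt; apply/negP => lt_i.
by have := sumn_lt ge_M lt_i; rewrite -[X in (_ < X)%N]/(deg M) degM ltnn.
Qed.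

(* Moving one unit from a variable where M exceeds M' to one where it falls
   short is a step of some e_{i,j} with nonzero coefficient: an odd variable
   that falls short has exponent 0 in M. *)
Lemma mono_connected U M M' : subspace U -> (forall i j w, U w -> U (G i * D j w)) ->
  deg M = deg M' -> U (mono M) -> U (mono M').
Proof.
(* The truncated differences add up to the number of units still to be moved from M to M'. *)
move=> sU Ue; have [d] := ubnP (\sum_i (mult M i - mult M' i))%N.
elim: d M => // d IHd M lt_d degM UM.
have [<- //|neqM] := eqVneq M M'.
have [i lt_i] := mult_lt_ex degM neqM.
have [j lt_j] : exists j, (mult M' j < mult M j)%N.
  by apply: mult_lt_ex; rewrite // eq_sym.
have nij : j != i by apply: contraTneq lt_j => ->; rewrite -leqNgt ltnW.
have iM : ~~ odd_gen i || (mult (decr j M) i == 0%N).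
  rewrite mult_decr (negPf nij) subn0; case: (boolP (odd_gen i)) => //= odd_i.
  by rewrite -leqn0 -ltnS (leq_trans lt_i) ?mult_odd.
have jM : (0 < mult M j)%N by exact: leq_ltn_trans lt_j.
apply: (IHd (incr i (decr j M))).
(* The measure loses one at j and gains nothing at i, where the truncated difference is 0 before and
   after the move. *)
- rewrite -ltnS (leq_trans _ lt_d) // ltnS (sumn_lt (x := j)) // => [k|].
    rewrite mult_incr // mult_decr; case: (eqVneq i k) => [<-|]; last first.
      by rewrite addn0 leq_sub2r ?leq_subr.
    by rewrite (negPf nij) subn0 addn1 (eqP (_ : _ - _ == 0)%N) ?subn_eq0.
  rewrite mult_incr // mult_decr eqxx eq_sym (negPf nij) addn0 subnAC subn1.
  by rewrite prednK // subn_gt0.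
- by rewrite deg_incr // -deg_decr.
- apply: (mono_scaled (c := dcoef j M * gcoef i (decr j M))) => //.
    by rewrite mulf_neq0 ?dcoef_neq0 ?gcoef_neq0.
  by rewrite -GD_mono2; exact: Ue.
Qed.

(** Lets the stability proofs assume that the structure constant is nonzero, which excludes the
    degenerate values of [incr] and [decr]. *)
Lemma span_of_scaled q c M : (c != 0 -> q M) -> span_of q (c *: mono M).
Proof.
move=> qM; have [->|c0] := eqVneq c 0.
  by rewrite scale0r; exact: (subspace_span_of q).1.
exact: (subspaceZ _ (subspace_span_of q) (span_of_mono (qM c0))).
Qed.

Lemma GD_neq0 i j M : dcoef j M * gcoef i (decr j M) != 0 ->
  deg (incr i (decr j M)) = deg M.
Proof.
rewrite mulf_eq0 negb_or gcoef_neq0 => /andP[dM iM].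
rewrite deg_incr // -deg_decr // lt0n.
by apply: contraNneq dM => /dcoef0->.
Qed.

(** The predicate d on degrees serves both for a single degree and for all degrees above k. *)
Lemma span_of_GD (d : pred nat) i j w : span_of (fun M => d (deg M)) w ->
  span_of (fun M => d (deg M)) (G i * D j w).
Proof.
apply: (lin_stable (lin_GD i j) (subspace_span_of (fun M => d (deg M)))) => M dM.
by rewrite GD_mono2; apply: span_of_scaled => /GD_neq0->.
Qed.

Lemma Wdeg_Salg mu s : submodule (Salg p.+1 n mu) (Wdeg F p.+1 n s).
Proof.
rewrite WdegE; apply: Salg_stable; first exact: subspace_span_of.
by move=> i j w; exact: (@span_of_GD (pred1 s)).
Qed.

Lemma submodule_Salg mu U : submodule (Salg p.+1 n mu) U ->
  subspace U /\ forall i j w, U w -> U (G i * D j w).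
Proof. by move=> [sU US]; split=> // i j w; apply: US (Salg_GD mu i j). Qed.

Lemma Wdeg_sub U M : subspace U -> (forall i j w, U w -> U (G i * D j w)) ->
  U (mono M) -> Wdeg F p.+1 n (deg M) `<=` U.
Proof.
move=> sU Ue UM; rewrite WdegE; apply: span_of_sub => // M' /eqP EM.
exact: mono_connected UM.
Qed.

(** Taking the degree of a given monomial guarantees that the space is nonzero. A nonzero submodule
    contains a monomial by [mono_component], hence all those of the same degree by
    [mono_connected]. *)
Lemma Wdeg_irreducible mu M : irreducible (Salg p.+1 n mu) (Wdeg F p.+1 n (deg M)).
Proof.
split; first exact: Wdeg_Salg.
  move=> E; have : Wdeg F p.+1 n (deg M) (mono M) by rewrite WdegE; exact: span_of_mono.
  by rewrite E => /eqP; rewrite (negPf (mono_neq0 M)).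
move=> N NS NW; have [sN Ne] := submodule_Salg NS.
have [N0|] := pselect (N `<=` [set 0]).
  by left; apply/seteqP; split=> // _ ->; exact: sN.1.
move=> /nonsubset[w [Nw w0]]; right; apply/seteqP; split=> //.
have [M' cM'] : exists M', coef w M' != 0.
  apply: contrapT => /forallNP c0; apply: w0; apply: coef_inj => M'.
  by rewrite coef0; apply/eqP/negPn/negP; exact: c0.
have degM' : deg M' = deg M.
  by have := NW _ Nw; rewrite WdegE => /(_ _ cM')/eqP.
rewrite -degM'; apply: Wdeg_sub => //; apply: mono_scaled cM' _ => //.
exact: (mono_component _ sN (fun i u => Ne i i u)).
Qed.

Lemma generated_Wdeg mu M c : c != 0 ->
  generated (Salg p.+1 n mu) (c *: mono M) = Wdeg F p.+1 n (deg M).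
Proof.
move=> c0; apply/seteqP; split=> w Mw.
  apply: (Mw (Wdeg F p.+1 n (deg M))); first exact: Wdeg_Salg.
  by rewrite WdegE; exact: span_of_scaled.
move=> U /submodule_Salg[sU Ue] UM; apply: (Wdeg_sub sU Ue _ Mw).
exact: (mono_scaled sU c0 UM).
Qed.

(** For i < j, the raising operator kills M either because variable j is absent from M or because
    variable i is odd and already present. The first case serves for powers of [x_ 2], both for
    products of the [y_]. *)
Lemma highest_weight mu M c (l : 'rV[F]_(p + n)) : c != 0 ->
  (forall i, l 0 i = (mult M i)%:R) ->
  (forall i j, (i < j)%N -> mult M j = 0%N \/ odd_gen i /\ mult M i = 1%N) ->
  @highest_weight_vector F p.+1 n mu (Wdeg F p.+1 n (deg M)) (c *: mono M) l.
Proof.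
move=> c0 lM hM; split; last exact: generated_Wdeg.
- by rewrite scaler_eq0 negb_or c0 mono_neq0.
- move=> h; rewrite /pairing scaler_suml; apply: eq_bigr => i _.
  rewrite e_E (linZ _ _ (lin_GD i i)) GD_mono lM !scalerA.
  by rewrite mulrAC [h 0 i * _]mulrC [c * _]mulrC.
move=> [|[|i]] [|[|j]] // _ lt_ij lt_j.
have lt_i : (i < p + n)%N by exact: ltn_trans (lt_ij : (i < j)%N) lt_j.
rewrite (e_E mu (Ordinal lt_i) (Ordinal (lt_j : (j < p + n)%N))).
rewrite (linZ _ _ (lin_GD _ _)) GD_mono2.
have [/dcoef0->|[odd_i Mi]] := hM (Ordinal lt_i) (Ordinal (lt_j : (j < p + n)%N)) lt_ij.
  by rewrite mul0r scale0r scaler0.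
(* Lowering j leaves the exponent 1 of the odd variable i unchanged, so multiplying by it again
   gives 0. *)
have /eqP-> : gcoef (Ordinal lt_i) (decr (Ordinal (lt_j : (j < p + n)%N)) M) == 0.
  rewrite -[_ == 0]negbK gcoef_neq0 odd_i mult_decr Mi.
  by rewrite -val_eqE /= [j == i]gtn_eqF.
by rewrite mulr0 scale0r scaler0.
Qed.


(** * The submodule V(mu) as the part of degree above mu *)

Lemma mono_generated k U M M' : submodule (@gl F p.+1 n k%:R) U ->
  deg M = k.+1 -> U (mono M) -> (k < deg M')%N -> U (mono M').
Proof.
move=> Ugl degM UM; have [sU _] := Ugl.
have UGD i j w : U w -> U (G i * D j w).
  by move=> Uw; rewrite -(e_E k%:R); apply: gl_e_ => //; exact: ltn_ord.
have UG i w : U w -> U (G i * w).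
  by move=> Uw; rewrite -(e_G k%:R); apply: gl_e_ => //; exact: ltn_ord.
(* Induction on the excess of degree over k + 1: connectivity settles excess 0, and multiplication
   by a generator raises the excess by one. *)
move=> /subnKC; move: (deg M' - k.+1)%N => d; elim: d M' => [|d IHd] M' EM'.
  by apply: mono_connected UM => //; rewrite -EM' addn0.
have [i Mi] : exists i, (0 < mult M' i)%N.
  apply/existsP; apply: contraT; rewrite negb_exists => /forallP M0.
  have : deg M' = 0%N.
    apply/eqP; rewrite sum_nat_eq0; apply/forall_inP => i _.
    by have := M0 i; rewrite lt0n negbK.
  by rewrite -EM'.
have g0 : gcoef i (decr i M') != 0 by rewrite gcoef_neq0 mult_decr_odd.
apply: (mono_scaled sU g0); rewrite -{2}(incr_decr Mi) -G_mono.
apply/UG/IHd; apply: succn_inj; rewrite -(deg_decr Mi).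
by rewrite -EM' -addnS.
Qed.

Lemma span_of_gl k : submodule (@gl F p.+1 n k%:R) (span_of (fun M => k < deg M)%N).
Proof.
have sU := subspace_span_of (fun M => k < deg M)%N.
have Ue w : span_of (fun M => k < deg M)%N w ->
    span_of (fun M => k < deg M)%N (e11 k%:R w).
  apply: (lin_stable (lin_e11 _) sU) => M kM.
  by rewrite e11_mono; apply: span_of_scaled.
apply: gl_stable => // [i j w|i w|i w].
- exact: (@span_of_GD (fun d => k < d)%N).
- apply: (lin_stable (lin_mul (G i)) sU) => M kM; rewrite G_mono.
  by apply: span_of_scaled; rewrite gcoef_neq0 => iM; rewrite deg_incr // ltnW.
apply: (lin_stable (lin_comp (lin_e11 _) (@lin_D i)) sU) => M kM /=.
rewrite D_mono (linZ _ _ (lin_e11 _)) e11_mono scalerA.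
apply: span_of_scaled; rewrite mulf_eq0 negb_or => /andP[dM kdM].
have Mi : (0 < mult M i)%N by rewrite lt0n; apply: contraNneq dM => /dcoef0->.
(* Degree k could only be reached from degree k + 1, and there [e11] contributes the factor k - k =
   0. *)
rewrite ltn_neqAle -ltnS -deg_decr // kM andbT.
by apply: contraNneq kdM => <-; rewrite subrr.
Qed.

Lemma generated_gl k c M : c != 0 -> deg M = k.+1 ->
  generated (@gl F p.+1 n k%:R) (c *: mono M) = span_of (fun M => k < deg M)%N.
Proof.
move=> c0 degM; apply/seteqP; split=> w Mw.
  apply: (Mw (span_of (fun M => k < deg M)%N)); first exact: span_of_gl.
  by apply: span_of_scaled; rewrite degM.
move=> U Ugl UM; apply: (span_of_sub Ugl.1 _ Mw) => M' kM'.
exact: (mono_generated Ugl degM (mono_scaled Ugl.1 c0 UM)).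
Qed.

Lemma oneE : 1 = mono (0%MM, finset.set0).
Proof.
by apply/ffunP => A; rewrite !ffunE /=; case: eqP => _; rewrite ?mpolyX0.
Qed.

Lemma x2_expE s : (0 < p)%N -> exists M,
  [/\ x_ F p.+1 n 2 ^+ s = mono M, deg M = s &
      forall i, mult M i = ((i == 0 :> nat) * s)%N].
Proof.
move=> p0; pose a := Ordinal p0; pose i0 : 'I_(p + n) := unsplit (inl a).
have x2E : x_ F p.+1 n 2 = G i0 by rewrite -genE /gen /= ltnS p0.
have even_i0 : ~~ odd_gen i0 by rewrite /odd_gen /= -ltnNge.
elim: s => [|s [M [xM degM multM]]].
  exists (0%MM, finset.set0); split=> [||i].
  - by rewrite expr0 oneE.
  - by rewrite degE /= mdeg0 cards0.
  by rewrite muln0 /mult; case: (split i) => b /=; rewrite ?mnm0E ?inE.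
exists (incr i0 M); split=> [||i].
- rewrite exprS xM x2E G_mono (_ : gcoef i0 M = 1) ?scale1r //.
  by rewrite /gcoef /i0 unsplitK.
- by rewrite deg_incr ?even_i0 // degM.
by rewrite mult_incr ?even_i0 // multM -val_eqE /= mulnS addnC eq_sym.
Qed.

(** The scalar c collects the coefficients [gcoef]; its nonvanishing is enough for generation and
    for highest weight vectors. *)
Lemma prod_yE s : (s <= n)%N -> exists c M, [/\ c != 0,
  \prod_(1 <= k < s.+1) y_ F p.+1 n k = c *: mono M, deg M = s &
  forall i, mult M i = ((p <= i < p + s)%N : nat)].
Proof.
move=> sn; rewrite big_add1 /=.
(* Since [G_mono] multiplies on the left, the product is built from its last d factors. *)
suff H d : (d <= s)%N -> exists c M, [/\ c != 0,
    \prod_((s - d)%N <= k < s) y_ F p.+1 n k.+1 = c *: mono M, deg M = d &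
    forall i, mult M i = ((p + (s - d) <= i < p + s)%N : nat)].
  by have := H _ (leqnn s); rewrite subnn addn0.
elim: d => [|d IHd] ds.
  exists 1, (0%MM, finset.set0); split=> [|||i].
  - exact: oner_neq0.
  - by rewrite subn0 big_geq // scale1r oneE.
  - by rewrite degE /= mdeg0 cards0.
  rewrite subn0 leqNgt andNb.
  by rewrite /mult; case: (split i) => b /=; rewrite ?mnm0E ?inE.
have [c [M [c0 EM degM multM]]] := IHd (ltnW ds).
have lt_s : (s - d.+1 < s)%N by rewrite ltn_subrL (leq_ltn_trans _ ds).
have lt_n : (s - d.+1 < n)%N by exact: leq_trans sn.
pose k := Ordinal lt_n; pose i0 : 'I_(p + n) := unsplit (inr k).
have i0M : mult M i0 == 0%N.
  by rewrite multM /= leq_add2l -ltnS subnSK // ltnn.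
exists (c * gcoef i0 M), (incr i0 M); split=> [|||i].
- by rewrite mulf_neq0 // gcoef_neq0 i0M orbT.
- rewrite big_ltn // {2}(subnSK ds) EM -scalerAr -scalerA -G_mono /G /i0 unsplitK.
  by rewrite /y_ (big_pred1 k).
- by rewrite deg_incr ?i0M ?orbT // degM.
rewrite mult_incr ?i0M ?orbT // multM -val_eqE /= -(subnSK ds) addnS eq_sym.
by case: (ltngtP (p + (s - d.+1))%N i) => [_|_|<-] /=; rewrite ?addn0 // ltn_add2l lt_s.
Qed.

Lemma V_E k : V F p.+1 n k = span_of (fun M => k < deg M)%N.
Proof.
rewrite /V ltnS; case: ifP => [p0|/negbT].
  have [M [-> degM _]] := x2_expE k.+1 p0.
  by rewrite -[mono M]scale1r (generated_gl (oner_neq0 _)).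
rewrite -eqn0Ngt => /eqP p0; case: ifP => [kn|/negbT kn].
  by have [c [M [c0 -> degM _]]] := prod_yE kn; apply: generated_gl.
(* With no even variable, degrees are at most n, so for k >= n no monomial has degree above k. *)
apply/seteqP; split=> w /=; first by move=> ->; exact: (subspace_span_of _).1.
move=> wk; apply: coef_inj => M; rewrite coef0; apply/eqP.
apply: contraNT kn => /wk /leq_trans; apply.
rewrite degE mdegE big1 => [|a _]; last by move: (ltn_ord a); rewrite {2}p0.
by rewrite add0n (leq_trans (max_card _)) ?card_ord.
Qed.


(** * Characters *)

(* The weight of the monomial is mu epsilon_1 + weight M. *)
Definition weight M : 'rV[F]_(p.+1 + n) :=
  \row_j (if unlift ord0 (j : 'I_(p + n).+1) is Some i then (mult M i)%:R
          else - (deg M)%:R).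

Lemma weight_inj : injective weight.
Proof.
move=> M M' /rowP E; apply: mult_inj => i; apply: natr_injF.
by have := E (lift (ord0 : 'I_(p + n).+1) i); rewrite !mxE liftK.
Qed.

Lemma e_weight mu M (j : 'I_(p.+1 + n)) :
  @e_ F p.+1 n mu j.+1 j.+1 (mono M) = (mu *: eps F p.+1 n 1 + weight M) 0 j *: mono M.
Proof.
rewrite !mxE; case: (unliftP ord0 (j : 'I_(p + n).+1)) => [i|] -> /=.
  by rewrite (e_E mu i i) GD_mono mulr0 add0r.
by rewrite mulr1 -e11_mono.
Qed.

Lemma act_diagE mu h w : @act F p.+1 n mu (diag_mx h) w =
  \sum_j h 0 j *: e_ mu j.+1 j.+1 w.
Proof.
apply: eq_bigr => i _; rewrite (bigD1 i) //= big1 ?addr0 => [|j nj].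
  by rewrite mxE eqxx mulr1n.
by rewrite mxE eq_sym (negPf nj) mulr0n scale0r.
Qed.

Lemma lin_act_diag mu h : lin (@act F p.+1 n mu (diag_mx h)).
Proof.
have -> : act mu (diag_mx h) = fun w => \sum_j h 0 j *: @e_ F p.+1 n mu j.+1 j.+1 w.
  by apply: funext => w; exact: act_diagE.
apply: lin_sum => j; apply: lin_scale.
case: (unliftP ord0 (j : 'I_(p + n).+1)) => [i|] -> /=; last exact: lin_e11.
have -> : @e_ F p.+1 n mu i.+2 i.+2 = fun w => G i * D i w.
  by apply: funext => w; rewrite e_E.
exact: lin_GD.
Qed.

Lemma coef_act_diag mu h w M : coef (@act F p.+1 n mu (diag_mx h) w) M =
  pairing (mu *: eps F p.+1 n 1 + weight M) h * coef w M.
Proof.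
apply: (coef_diag (e := fun M => pairing (mu *: eps F p.+1 n 1 + weight M) h)).
  exact: lin_act_diag.
move=> M'; rewrite act_diagE /pairing scaler_suml.
by apply: eq_bigr => j _; rewrite e_weight scalerA mulrC.
Qed.

Lemma weight_space_span mu q (l : 'rV[F]_(p.+1 + n)) :
  weight_space mu (span_of q) l =
  span_of (fun M => q M && (mu *: eps F p.+1 n 1 + weight M == l)).
Proof.
apply/seteqP; split=> w.
  move=> [qw wl] M cM; rewrite qw //=; apply/eqP/rowP => j.
  (* Testing on the j-th diagonal matrix unit isolates the j-th coordinate of the weight. *)
  have := congr1 (coef^~ M) (wl (delta_mx 0 j)).
  rewrite coef_act_diag coefZ => /(mulIf cM).
  have pairE (l' : 'rV[F]_(p.+1 + n)) : pairing l' (delta_mx 0 j) = l' 0 j.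
    rewrite /pairing (bigD1 j) //= big1 ?addr0 => [|i ni]; rewrite mxE ?eqxx ?mulr1 //.
    by rewrite (negPf ni) andbF mulr0.
  by rewrite !pairE.
move=> ql; split=> [M /ql/andP[]//|h]; apply: coef_inj => M.
rewrite coef_act_diag coefZ; have [->|/ql/andP[_ /eqP->]//] := eqVneq (coef w M) 0.
by rewrite !mulr0.
Qed.

(** * Dimensions of weight spaces *)

Local Notation dim := (@Defs.dim F p.+1 n).

(** [dim] chooses some size of a basis, so computing it requires uniqueness of that size. As weights
    of monomials are distinct, only dimensions 0 and 1 have to be treated. *)
Lemma dimE U d : has_dim U d -> (forall d', has_dim U d' -> d' = d) -> dim U = d.
Proof. by move=> Ud dU; apply: xget_unique. Qed.

Lemma has_dim0 : has_dim [set (0 : W)] 0.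
Proof.
exists (fun=> 0); split=> [c _ []//|]; apply/seteqP; split=> [_ ->|_ [c _ <-]] /=.
  by exists (fun=> 0) => //; rewrite big_ord0.
by rewrite big_ord0.
Qed.

Lemma sum_delta d (b : 'I_d -> W) x : \sum_y (y == x)%:R *: b y = b x.
Proof.
by rewrite (bigD1 x) //= eqxx scale1r big1 ?addr0 // => y /negPf->; rewrite scale0r.
Qed.

Lemma dim0 : dim [set (0 : W)] = 0%N.
Proof.
apply: dimE has_dim0 _ => -[//|d] [b [free_b span_b]].
have : (1 : F) = 0; last by move/eqP; rewrite oner_eq0.
suff b0 x : b x = 0.
  by apply: (free_b (fun=> 1) _ ord0); apply: big1 => x _; rewrite b0 scaler0.
suff : [set (0 : W)] (b x) by [].
by rewrite span_b; exists (fun y => (y == x)%:R) => //; exact: sum_delta.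
Qed.

Lemma has_dim1 (v : W) : v != 0 -> has_dim [set c *: v | c in [set: F]] 1.
Proof.
move=> v0; exists (fun=> v); split=> [c|].
  rewrite big_ord1 => /eqP; rewrite scaler_eq0 (negPf v0) orbF => /eqP c0 i.
  by rewrite ord1.
apply/seteqP; split=> [_ [c _ <-]|_ [c _ <-]].
  by exists (fun=> c) => //; rewrite big_ord1.
by exists (c ord0) => //; rewrite big_ord1.
Qed.

Lemma dim1 (v : W) : v != 0 -> dim [set c *: v | c in [set: F]] = 1%N.
Proof.
move=> v0; apply: dimE (has_dim1 v0) _ => d [b [free_b span_b]].
have b_in x : exists a : F, b x = a *: v.
  have : [set c *: v | c in [set: F]] (b x).
    by rewrite span_b; exists (fun y => (y == x)%:R) => //; exact: sum_delta.
  by case=> a _ <-; exists a.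
have [a bE] := choice b_in.
case: d b free_b span_b b_in a bE => [|[//|d]] b free_b span_b _ a bE.
  have : [set c *: v | c in [set: F]] v by exists 1; rewrite ?scale1r.
  by rewrite span_b => -[c _]; rewrite big_ord0 => /esym/eqP; rewrite (negPf v0).
pose i1 := lift ord0 ord0 : 'I_d.+2.
have a0 : a ord0 != 0.
  apply/eqP => a0; have := free_b (fun x => (x == ord0)%:R).
  by rewrite sum_delta bE a0 scale0r => /(_ erefl ord0)/eqP; rewrite eqxx oner_eq0.
(* If [b ord0] and [b i1] are the multiples a0 v and a1 v of v, then a1 (a0 v) - a0 (a1 v) = 0 is a
   nontrivial relation. *)
have := free_b (fun x => if x == ord0 then a i1 else if x == i1 then - a ord0 else 0).
rewrite (bigD1 ord0) //= (bigD1 i1) //= big1 => [|x /andP[/negPf-> /negPf->]]; last first.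
  by rewrite scale0r.
rewrite !bE addr0 !scalerA mulNr mulrC scaleNr subrr => /(_ erefl i1)/eqP.
by rewrite /= oppr_eq0 (negPf a0).
Qed.

Lemma span_of_pred0 q : (forall M, ~~ q M) -> span_of q = [set 0].
Proof.
move=> q0; apply/seteqP; split=> [w qw|_ ->]; last exact: (subspace_span_of q).1.
apply: coef_inj => M; rewrite coef0; apply/eqP; apply: contraT => /qw.
by rewrite (negPf (q0 M)).
Qed.

Lemma span_of_pred1 q M : q =1 pred1 M -> span_of q = [set c *: mono M | c in [set: F]].
Proof.
move=> qM; apply/seteqP; split=> [w qw|_ [c _ <-]]; last first.
  by apply: span_of_scaled; rewrite qM /= eqxx.
exists (coef w M) => //; apply: coef_inj => M'; rewrite coefZ coef_mono.
have [<-|neq] := eqVneq M M'; first by rewrite mulr1.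
rewrite mulr0; apply/esym/eqP; apply: contraT => /qw.
by rewrite qM /= eq_sym (negPf neq).
Qed.

(** By [weight_inj] at most one monomial has a given weight, so each multiplicity is a truth
    value. *)
Lemma span_of_character mu q : has_character mu (span_of q)
  (fun l => `[< exists2 M, q M & mu *: eps F p.+1 n 1 + weight M = l >] : nat).
Proof.
pose r l M := q M && (mu *: eps F p.+1 n 1 + weight M == l).
have rP l : (exists M, r l =1 pred1 M) \/ (forall M, ~~ r l M).
  have [[M rM]|/forallNP r0] := pselect (exists M, r l M); last first.
    by right=> M; apply/negP; exact: r0.
  left; exists M => M' /=; apply/idP/eqP => [|->//].
  move: rM; rewrite /r => /andP[_ /eqP <-] /andP[_].
  by rewrite (inj_eq (addrI _)) => /eqP/weight_inj.
split.
(* [M0] is only the default of [nth], never reached for indices below [size s]. *)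
- move=> w qw; pose s := supp w; pose M0 : mon := (0%MM, finset.set0).
  exists (size s), (fun x => mu *: eps F p.+1 n 1 + weight (nth M0 s x)).
  exists (fun x => coef w (nth M0 s x) *: mono (nth M0 s x)).
  split=> [x|]; last by rewrite {1}[w]monoE (big_nth M0) big_mkord.
  rewrite weight_space_span; apply: span_of_scaled => /qw ->; exact: eqxx.
- move=> l; rewrite weight_space_span.
  have [[M rM]|r0] := rP l.
    by exists 1; rewrite (span_of_pred1 rM); exact: has_dim1 (mono_neq0 M).
  by exists 0; rewrite (span_of_pred0 r0); exact: has_dim0.
apply: funext => l; rewrite /Ch weight_space_span.
have [[M rM]|r0] := rP l.
  rewrite (span_of_pred1 rM) dim1 ?mono_neq0 // asboolT //.
  by have := rM M; rewrite /= eqxx => /andP[qM /eqP lM]; exists M.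
rewrite (span_of_pred0 r0) dim0 asboolF // => -[M qM /eqP lM].
by have := r0 M; rewrite /r qM lM.
Qed.

(** * The index sets P and Q as sets of weights of monomials *)

Lemma formal_sum_fexp (A : set 'rV[F]_(p.+1 + n)) l0 :
  @formal_sum F p.+1 n A (fun a => fexp (l0 + a)) =
  (fun l => `[< exists2 a, A a & l0 + a = l >] : nat).
Proof.
apply: funext => l; rewrite /formal_sum /fexp.
have [Al|Al] := pselect (A (l - l0)).
  rewrite asboolT; last by exists (l - l0) => //; rewrite addrC subrK.
  (* Only a = l - l0 contributes at l, so the support is finite and the sum does not fall back on
     its default value. *)
  rewrite -(@fsbig_widen _ _ _ _ [set l - l0]) ?fsbig_set1.
  - by rewrite addrC subrK eqxx.
  - by move=> _ ->.
  move=> a [_ /= na]; apply/eqP; rewrite eqb0; apply: contra_notN na => /eqP->.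
  by rewrite addrAC subrr add0r.
rewrite asboolF => [|[a Aa E]]; last by apply: Al; rewrite -E addrAC subrr add0r.
apply: fsbig1 => a Aa; apply/eqP; rewrite eqb0; apply: contra_notN Al => /eqP->.
by rewrite addrAC subrr add0r.
Qed.

Lemma sum_pick a b k (f : nat -> F) : \sum_(a <= i < b) f i * (k == i)%:R =
  if (a <= k < b)%N then f k else 0.
Proof.
case: ifP => k_in; last first.
  rewrite big1_seq // => i; rewrite mem_index_iota => /andP[_ i_in].
  by case: eqP k_in => [->|_ _]; rewrite ?i_in ?mulr0.
rewrite (bigD1_seq k) ?mem_index_iota ?iota_uniq //= eqxx mulr1 big1 ?addr0 //.
by move=> i /negPf nik; rewrite eq_sym nik mulr0.
Qed.

(** Abel summation: the coefficient of epsilon_(i+2) is the difference of consecutive t's, that of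
    epsilon_1 is minus t 1, and t 1 is the telescoping sum of all exponents. *)
Lemma combE t M : t (p.+1 + n)%N = 0 ->
  (forall i : 'I_(p + n), t i.+1 - t i.+2 = (mult M i)%:Z) ->
  comb F p.+1 n t = weight M /\ t 1%N = (deg M)%:Z.
Proof.
move=> tN tM; have t1 : t 1%N = (deg M)%:Z.
  rewrite -natz natr_sum; under eq_bigr => i _ do rewrite natz -tM.
  rewrite -(big_mkord xpredT (fun k => t k.+1 - t k.+2)).
  rewrite (telescope_sumr_eq (fun k => - t k.+1)) // => [|k _]; last first.
    by rewrite opprK addrC.
  by rewrite opprK tN oppr0 add0r.
split=> //; apply/rowP => j; rewrite summxE.
under eq_bigr => k _ do rewrite !mxE eqSS mulrBr.
rewrite sumrB !sum_pick ltn_ord andbT.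
(* The index m + n lies outside the range of the sum, but t vanishes there. *)
have -> : (if (0 < j.+1 < p.+1 + n)%N then (- t j.+1)%:~R else 0) = (- t j.+1)%:~R :> F.
  case: ifP => // /negbT; rewrite /= -leqNgt => le_N.
  by rewrite (_ : j.+1 = p.+1 + n)%N ?tN ?oppr0 //; apply/eqP; rewrite eqn_leq ltn_ord.
rewrite mxE; case: (unliftP ord0 (j : 'I_(p + n).+1)) => [i|] -> /=.
  by rewrite -intrB opprK addrC tM.
by rewrite subr0 t1 mulrNz.
Qed.

(** Consecutive differences are nonnegative, and from index m on they are 0 or 1: exactly the
    exponents allowed for even and odd variables. *)
Lemma admissible_mono t : admissible p.+1 n t -> exists M,
  forall i : 'I_(p + n), t i.+1 - t i.+2 = (mult M i)%:Z.
Proof.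
move=> [t_le _ t01].
exists ([multinom `|t (a : 'I_p).+1 - t a.+2|%N | a < p],
        [set k : 'I_n | t (p + k).+1 - t (p + k).+2 == 1]%SET) => i.
have lt_i : (i.+1 < p.+1 + n)%N by exact: ltn_ord.
rewrite /mult; case: splitP => [a|k] E /=.
  by rewrite mnmE -E gez0_abs // subr_ge0 t_le.
rewrite inE -E; have := t01 i.+1; rewrite E ltnS leq_addr -E lt_i => /(_ isT).
by rewrite !inE => /orP[] /eqP->.
Qed.

(* The inverse of t |-> (t_i - t_(i+1))_i, with t_(m+n) = 0. *)
Definition tail_deg M (k : nat) : int := \sum_(i < p + n | (k <= i.+1)%N) (mult M i)%:Z.

Lemma tail_degB M i : tail_deg M i.+1 - tail_deg M i.+2 = (mult M i)%:Z.
Proof.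
rewrite /tail_deg (bigD1 i) //=.
under eq_bigl => j do rewrite ltnS andbC eq_sym -ltn_neqAle.
by rewrite addrK.
Qed.

Lemma tail_deg_admissible M : admissible p.+1 n (tail_deg M).
Proof.
split=> [[|k]//= lt_k||[|k]// /andP[le_k lt_k]].
- by rewrite -subr_ge0 (tail_degB M (Ordinal (lt_k : (k < p + n)%N))).
- by rewrite /tail_deg big1 // => i; rewrite ltnS leqNgt ltn_ord.
rewrite (tail_degB M (Ordinal (lt_k : (k < p + n)%N))).
have := @mult_odd (Ordinal (lt_k : (k < p + n)%N)) M le_k.
by case: (mult _ _) => [|[|]].
Qed.

Lemma P_E : P F p.+1 n = range weight.
Proof.
apply/seteqP; split=> [_ [t tP <-]|_ [M _ <-]].
  have [M tM] := admissible_mono tP; exists M => //.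
  by have [_ tN _] := tP; have [->] := combE tN tM.
have [_ tN _] := tail_deg_admissible M; exists (tail_deg M).
  exact: tail_deg_admissible.
by have [] := combE tN (tail_degB M).
Qed.

Lemma Q_E k : Q F p.+1 n k = [set weight M | M in [set M | (k < deg M)%N]].
Proof.
apply/seteqP; split=> [_ [t [tP kt] <-]|_ [M kM <-]].
  have [M tM] := admissible_mono tP; have [_ tN _] := tP.
  have [-> t1] := combE tN tM; exists M => //=.
  by move: kt; rewrite t1 lez_nat.
have [_ tN _] := tail_deg_admissible M; have [EM t1] := combE tN (tail_degB M).
exists (tail_deg M) => //; split; first exact: tail_deg_admissible.
by rewrite t1 lez_nat.
Qed.

Lemma character_weights mu q : has_character mu (span_of q)
  (formal_sum [set weight M | M in [set M | q M]]
    (fun a => fexp (mu *: eps F p.+1 n 1 + a))).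
Proof.
rewrite formal_sum_fexp; have := span_of_character mu q; congr has_character.
apply: funext => l; congr nat_of_bool; apply: asbool_equiv_eq.
split=> [[M qM El]|[_ [M qM <-] El]]; last by exists M.
by exists (weight M) => //; exists M.
Qed.

Lemma span_of_setT : span_of xpredT = setT.
Proof. by apply/seteqP; split. Qed.

End Monomials.

Theorem theorem2p6 (R : realType) (m n : nat) (hm : (1 <= m)%N) (mu : R[i]) :
  [/\ has_character mu [set: W R[i] m n]
        (formal_sum (P R[i] m n) (fun a => fexp (mu *: eps R[i] m n 1 + a))),
      forall k : nat, mu = k%:R ->
        has_character mu (V R[i] m n k)
          (formal_sum (Q R[i] m n k) (fun a => fexp (mu *: eps R[i] m n 1 + a))),
      (2 <= m)%N -> forall s : nat,
        irreducible (Salg m n mu) (Wdeg R[i] m n s) /\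
        highest_weight_vector mu (Wdeg R[i] m n s)
          (x_ R[i] m n 2 ^+ s)
          (s%:R *: epsS R[i] m n 2) &
      m = 1%N -> forall s : nat, (s <= n)%N ->
        irreducible (Salg m n mu) (Wdeg R[i] m n s) /\
        highest_weight_vector mu (Wdeg R[i] m n s)
          (\prod_(1 <= k < s.+1) y_ R[i] m n k)
          (\sum_(2 <= i < s.+2) epsS R[i] m n i)].
Proof.
case: m hm => // p _; have charC := @pchar_num R[i]; split.
- rewrite P_E -span_of_setT (_ : setT = [set M | xpredT M]); last first.
    by apply/seteqP; split.
  exact: (character_weights charC).
- by move=> k ->; rewrite V_E // Q_E; exact: (character_weights charC).
- move=> p0 s; have [M [-> degM multM]] := @x2_expE R[i] p n s p0.
  (* The degree s is turned back into [deg M], the form in which irreducibility was proved. *)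
  rewrite -{1 2}degM; split; first exact: Wdeg_irreducible.
  rewrite -[mono _ M]scale1r; apply: highest_weight => // [|i|i j lt_ij].
  + exact: oner_neq0.
  + by rewrite multM !mxE eqSS eqSS mulrC -natrM.
  + by left; rewrite multM gtn_eqF // (leq_ltn_trans _ lt_ij).
move=> [p0]; subst p => s sn.
have [c [M [c0 -> degM multM]]] := @prod_yE R[i] 0 n s sn.
rewrite -{1 2}degM; split; first exact: Wdeg_irreducible.
apply: highest_weight => // [i|i j lt_ij].
  rewrite multM summxE; under eq_bigr => k _ do rewrite !mxE -[_%:R]mul1r.
  by rewrite (sum_pick _ _ _ (fun=> 1)) [(0 + s)%N]add0n !ltnS; case: (_ < _)%N.
(* Here all variables are odd: either j is beyond the first s and absent, or i < j < s and variable
   i is present. *)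
rewrite !multM; case: (ltnP j (0 + s)) => [lt_j|_]; last by left; rewrite andbF.
by right; rewrite (ltn_trans lt_ij).
Qed.
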